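(* Let $(\mathcal M,\mathcal C)$ be a contact manifold. Let $X\in\mathfrak X(\mathcal M)$ be any representative of a class $[X]\in\Gamma(N\mathcal C)$, and let $h(X)\in\Gamma(\mathcal C)$ denote the unique $\mathcal C$-valued vector field satisfying $$[h(X),Y]\equiv[Y,X]\mod\mathcal C\qquad\text{for every }Y\in\Gamma(\mathcal C).$$ Then the assignment $[X]\mapsto C_{[X]}:=X+h(X)$ is well-defined (independent of the choice of the representative $X$) and establishes a one-to-one correspondence between sections of $N\mathcal C$ and contact vector fields on $\mathcal M$.
   Context: $\mathcal M$ is a smooth manifold and $\mathcal C\subset T\mathcal M$ a smooth co-rank one distribution; $\mathfrak X(\mathcal M)$ are the smooth vector fields on $\mathcal M$, $\Gamma(\mathcal C)$ the smooth $\mathcal C$-valued vector fields. The normal bundle is the line bundle $N\mathcal C=T\mathcal M/\mathcal C\to\mathcal M$, $\Gamma(N\mathcal C)$ its smooth sections, and $[X]$ the class of $X$ in $N\mathcal C$. The formula $\beta(X,Y)=[X,Y]\bmod\mathcal C$ for $X,Y\in\Gamma(\mathcal C)$ defines an $N\mathcal C$-valued 2-form $\beta:\Lambda^2\mathcal C\to N\mathcal C$. $(\mathcal M,\mathcal C)$ is a contact manifold if $\beta$ is non-degenerate, i.e. $\beta(X,\cdot)\equiv0$ implies $X\equiv0$. A contact vector field is a smooth vector field $X$ on $\mathcal M$ with $[X,\mathcal C]\subset\mathcal C$ (i.e. $[X,Y]\in\Gamma(\mathcal C)$ for every $Y\in\Gamma(\mathcal C)$). *)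

(* Defs.v *)
From mathcomp Require Import all_boot all_order all_algebra.
From mathcomp Require Import all_classical all_reals all_analysis.
Set Implicit Arguments.
Unset Strict Implicit.
Unset Printing Implicit Defensive.
Import Order.TTheory GRing.Theory Num.Theory.
Import numFieldNormedType.Exports.
Local Open Scope classical_set_scope.
Local Open Scope ring_scope.

(* [f] is of class C^k on the open set [U]: all iterated partial derivatives
   up to order [k] exist and are continuous on [U]. *)
Fixpoint class_C (R : realType) (n k : nat) (U : set 'rV[R]_n)
    (f : 'rV[R]_n -> R) : Prop :=
  (forall x, U x -> {for x, continuous f}) /\
  (if k is k'.+1 then
     forall i : 'I_n,
       (forall x, U x -> derivable f x (delta_mx 0 i)) /\
       class_C k' U (fun x => 'D_(delta_mx 0 i) f x)
   else True).

Definition class_Coo (R : realType) (n : nat) (U : set 'rV[R]_n)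
  (f : 'rV[R]_n -> R) : Prop := forall k, class_C k U f.

(* A homeomorphism from an open subset of [T] to an open subset of R^n;
   [chart_map] and [chart_inv] are irrelevant off [chart_dom] and
   [chart_cod]. *)
Record chart (R : realType) (n : nat) (T : topologicalType) := Chart {
  chart_dom : set T;
  chart_cod : set 'rV[R]_n;
  chart_map : T -> 'rV[R]_n;
  chart_inv : 'rV[R]_n -> T;
  chart_dom_open : open chart_dom;
  chart_cod_open : open chart_cod;
  chart_mapP : forall p, chart_dom p -> chart_cod (chart_map p);
  chart_invP : forall x, chart_cod x -> chart_dom (chart_inv x);
  chart_mapK : forall p, chart_dom p -> chart_inv (chart_map p) = p;
  chart_invK : forall x, chart_cod x -> chart_map (chart_inv x) = x;
  chart_map_continuous :
    forall p, chart_dom p -> {for p, continuous chart_map};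
  chart_inv_continuous :
    forall x, chart_cod x -> {for x, continuous chart_inv} }.

(* The image of [U] under the chart [c]. *)
Definition chart_image (R : realType) (n : nat) (T : topologicalType)
    (c : chart R n T) (U : set T) : set 'rV[R]_n :=
  [set x | chart_cod c x /\ U (chart_inv c x)].

(* The atlas need not be maximal: it determines the smooth structure. *)
Record manifold (R : realType) (n : nat) := Manifold {
  points :> topologicalType;
  atlas : set (chart R n points);
  manifold_hausdorff : hausdorff_space points;
  manifold_second_countable : @second_countable points;
  atlas_cover : forall p, exists2 c, atlas c & chart_dom c p;
  atlas_compatible : forall c d, atlas c -> atlas d -> forall j : 'I_n,
    class_Coo (chart_image c (chart_dom d))
              (fun x => chart_map d (chart_inv c x) 0 j) }.

Section Manifold.
Variables (R : realType) (n : nat) (M : manifold R n).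

Definition smooth_on (U : set M) (f : M -> R) : Prop :=
  forall c, atlas c ->
    class_Coo (chart_image c U) (fun x => f (chart_inv c x)).

Definition smooth (f : M -> R) : Prop := smooth_on setT f.

(* Tangent vectors at [p] are the derivations at [p] of the algebra of smooth
   functions.  They are total on [M -> R]; requiring the value 0 on non-smooth
   functions makes equality of tangent vectors mean equality of derivations. *)
Definition tvec : Type := ((M : Type) -> R) -> R.

Definition tangent (p : M) : set tvec := [set v |
  [/\ forall (a : R) (f g : M -> R), smooth f -> smooth g ->
        v (a *: f + g) = a * v f + v g,
      forall f g : M -> R, smooth f -> smooth g ->
        v (f * g) = f p * v g + g p * v f
    & forall f : M -> R, ~ smooth f -> v f = 0]].

Definition vfield : Type := (M : Type) -> tvec.

(* Smooth vector fields on an open set [U]; the values off [U] are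
   irrelevant. *)
Definition smooth_field_on (U : set M) (X : vfield) : Prop :=
  (forall p, U p -> tangent p (X p)) /\
  (forall f, smooth f -> smooth_on U (fun p => X p f)).

Definition vector_fields : set vfield := [set X | smooth_field_on setT X].

Definition bracket (X Y : vfield) : vfield :=
  fun p f => X p (fun q => Y q f) - Y p (fun q => X q f).

Definition combination (E : 'I_n -> vfield) (a : 'rV[R]_n) (p : M) : tvec :=
  \sum_i a 0 i *: E i p.

Definition tangent_frame_on (U : set M) (E : 'I_n -> vfield) : Prop :=
  (forall i, smooth_field_on U (E i)) /\
  (forall p, U p -> forall v, tangent p v ->
     exists! a : 'rV[R]_n, v = combination E a p).

(* A smooth subbundle of co-rank one of the tangent bundle: near every point
   there is a smooth frame of the tangent bundle all of whose members but one,
   [E i0], form a frame of [C]. *)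
Definition corank_one_distribution (C : M -> set tvec) : Prop :=
  forall p, exists (U : set M) (E : 'I_n -> vfield) (i0 : 'I_n),
    [/\ open U, U p, tangent_frame_on U E
      & forall q, U q ->
          C q = [set combination E a q | a in [set a : 'rV[R]_n | a 0 i0 = 0]]].

Variable C : M -> set tvec.

Definition sections : set vfield :=
  [set X | vector_fields X /\ forall p, C p (X p)].

(* The class of a tangent vector [v] at [p] in the fibre of the normal bundle
   at [p], as a coset. *)
Definition normal_class (p : M) (v : tvec) : set tvec :=
  [set w | C p (w - v)].

Definition normal_class_field (X : vfield) : M -> set tvec :=
  fun p => normal_class p (X p).

(* A section of the normal bundle is smooth when it lifts, near every point,
   to a smooth vector field. *)
Definition normal_sections : set (M -> set tvec) := [set s |
  forall p, exists (U : set M) (X : vfield),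
    [/\ open U, U p, smooth_field_on U X
      & forall q, U q -> s q = normal_class q (X q)]].

(* The value on the vectors [u] and [v] of [C p] of the normal-bundle-valued
   2-form (X, Y) |-> [X, Y] mod C, as a coset.  It depends only on the values
   of the sections X and Y at [p]. *)
Definition beta (p : M) (u v : tvec) : set tvec := [set w |
  exists X Y, [/\ sections X, sections Y, X p = u, Y p = v
                & normal_class p (bracket X Y p) w]].

(* Non-degeneracy is pointwise, as for any 2-form on a vector bundle. *)
Definition beta_nondegenerate : Prop :=
  forall p u, C p u ->
    (forall v, C p v -> beta p u v = normal_class p 0) -> u = 0.

Definition contact_structure : Prop :=
  corank_one_distribution C /\ beta_nondegenerate.

Definition contact_fields : set vfield := [set X |
  vector_fields X /\ forall Y, sections Y -> sections (bracket X Y)].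

Definition congruent_mod (X Y : vfield) : Prop := forall p, C p (X p - Y p).

Definition contact_correction (X Z : vfield) : Prop :=
  sections Z /\
  forall Y, sections Y -> congruent_mod (bracket Z Y) (bracket Y X).

End Manifold.

(* Main.v *)
Require Import Defs.
From mathcomp Require Import all_boot all_order all_algebra.
From mathcomp Require Import all_classical all_reals all_analysis.
From mathcomp Require Import ring lra.
Set Implicit Arguments.
Unset Strict Implicit.
Unset Printing Implicit Defensive.
Import Order.TTheory GRing.Theory Num.Theory.
Import numFieldNormedType.Exports.
Local Open Scope classical_set_scope.
Local Open Scope ring_scope.

(** The line of thought is pointwise.  Modulo [C], the bracket of a section of
    [C] with a vector field is tensorial in the section
    ([bracket_vanishing]).  The condition on [h X] at a point [q] therefore
    involves only the vector [u := h X q] of [C q]: it says that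
    [beta (u, Y q) = [Y, X] q] modulo [C q] for all [Y].  Call such a [u] a
    correction value.  Non-degeneracy gives at most one of them
    ([correction_value_uniq]), and in an adapted local frame they are the
    solution of an invertible linear system with smooth coefficients
    ([correction_value_local]).  Hence they exist, and they form a smooth field
    [h X].

    The field [X + h X] preserves [C] because its bracket with [Y] is
    [[X, Y] + [h X, Y]], which is in [C] by the choice of [h X]; it has the same
    class as [X] because [h X] is in [C].  It depends on that class only: if
    [X - X'] lies in [C], adding it to a correction value of [X] gives one of
    [X'].  Conversely a contact field has the correction [0], so it is the lift
    of its own class.

    The dependence on the class is local ([contact_lift_local]).  This also
    shows that every smooth section of the normal bundle comes from a global
    vector field ([normal_section_lift]): the contact lifts of local
    representatives agree on overlaps, so they glue without any partition of
    unity.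

    Two tools from differential geometry support this.  Bump functions
    ([bump_function]) extend local frames and coefficients to [M], which is
    needed because tangent vectors are derivations of global functions; they
    come from [exp (- 1 / t)].  Smoothness of the coefficients in a frame
    ([adapted_frame_exists]) does not use coordinates: independent derivations
    are separated by finitely many functions, and Cramer's rule applies. *)

(** * Flat functions *)

Section Flat.
Variable R : realType.
Implicit Types (t : R) (k : nat).

(** For [k = 0] this is the classical flat function [exp (- 1 / t)]; the factors
    [t ^- k] are those that its derivatives produce. *)
Definition flat k t : R := if 0 < t then t^-1 ^+ k * expR (- t^-1) else 0.

Lemma flat_gt0 k t : 0 < t -> 0 < flat k t.
Proof.
by move=> t0; rewrite /flat t0 mulr_gt0 ?expR_gt0 ?exprn_gt0 ?invr_gt0.
Qed.

Lemma flat_le0 k t : t <= 0 -> flat k t = 0.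
Proof. by move=> t0; rewrite /flat ltNge t0. Qed.

Lemma flatS k t : flat k.+1 t = t^-1 * flat k t.
Proof. by rewrite /flat; case: ifP => _; rewrite ?mulr0 // exprS mulrA. Qed.

(** [exp y] dominates [y ^ (k + 1) / (k + 1)!] at [y = 1 / t]. *)
Lemma flat_le_linear k t : `|flat k t| <= (k.+1)`!%:R * `|t|.
Proof.
have [t0|t0] := ltP 0 t; last by rewrite flat_le0 // normr0 mulr_ge0.
rewrite !gtr0_norm ?flat_gt0 //.
have y0 : 0 < t^-1 by rewrite invr_gt0.
have := expR_ge1Dxn k (ltW y0).
rewrite /flat t0; set y := t^-1 in y0 *; have -> : t = y^-1 by rewrite invrK.
rewrite expRN => h.
have f0 : 0 < (k.+1)`!%:R :> R by rewrite ltr0n fact_gt0.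
rewrite ler_pdivrMr ?expR_gt0 // mulrAC ler_pdivlMr //
  -exprSr mulrC -ler_pdivrMr //.
by apply: le_trans h; rewrite lerDr.
Qed.

(** Away from the origin this is calculus; at the origin the difference
    quotient of [flat k] is [flat k.+1], which tends to [0].  The family
    [flat] is thus stable under differentiation, which is all that smoothness
    needs. *)
Lemma is_derive_flat k t :
  is_derive t 1 (flat k) (flat k.+2 t - k%:R * flat k.+1 t).
Proof.
have [t0|t0|->] := ltrgtP t 0.
- rewrite !flat_le0 ?ltW // mulr0 subr0.
  apply: (@near_eq_is_derive _ _ _ (cst 0)).
  near=> s; rewrite /= flat_le0 //.
  by apply/ltW; near: s; exact: lt_nbhsl.
- have tN0 : t != 0 by rewrite gt_eqF.
  apply: (@near_eq_is_derive _ _ _ (fun s : R => s^-1 ^+ k * expR (- s^-1))).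
    near=> s; rewrite /flat ifT //.
    by near: s; exact: lt_nbhsr.
  have dV : is_derive t 1 (fun s : R => s^-1) (- t ^- 2).
    apply: is_derive_eq; first exact: is_deriveV.
    by rewrite /= /GRing.scale /= mulr1.
  have dE : is_derive t 1 (fun s : R => expR (- s^-1)) (expR (- t^-1) * t ^- 2).
    have dN : is_derive t 1 (fun s : R => - s^-1) (t ^- 2).
      by apply: is_derive_eq; rewrite opprK.
    exact: is_derive1_comp.
  have dX : is_derive t 1 (fun s : R => s^-1 ^+ k) (- (k%:R * t^-1 ^+ k.+1)).
    rewrite (_ : (fun s => _) = (fun s : R => s^-1) ^+ k); last first.
      by apply/funext => s; rewrite exprfctE.
    have := is_deriveX k dV; congr is_derive.
    case: k => [|k]; first by rewrite /GRing.scale /= !mulr0n !mul0r oppr0.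
    by rewrite /GRing.scale /= -exprVn mulrN -mulrA -exprD addn2.
  have := is_deriveM dX dE; congr is_derive.
  rewrite /flat t0 /GRing.scale /= -exprVn !exprS.
  by ring.
- rewrite !flat_le0 // mulr0 subr0.
  have lim0 : (fun h => h^-1 *: ((flat k \o shift 0) (h *: 1) - flat k 0))
      @ (0 : R)^' --> (0 : R).
    rewrite (_ : (fun h : R => _) = flat k.+1); last first.
      by apply/funext => h; rewrite /= flatS addr0 (flat_le0 k (lexx 0)) subr0
        /GRing.scale /= mulr1.
    apply/cvgr0Pnorm_lt => e e0.
    have f0 : 0 < (k.+2)`!%:R :> R by rewrite ltr0n fact_gt0.
    near=> h; apply: le_lt_trans (flat_le_linear _ _) _.
    rewrite mulrC -ltr_pdivlMr //; near: h; apply: dnbhs0_lt.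
    by rewrite divr_gt0.
  by apply: DeriveDef; [apply/cvg_ex; exists 0 | exact: cvg_lim lim0].
Unshelve. all: by end_near. Qed.

End Flat.

(** The line through [x] directed by [v] reduces a directional derivative to
    an ordinary one, so that no differentiability in several variables is
    required of [f]. *)
Lemma is_derive_comp1 (R : realType) (V : normedModType R) (h : R -> R)
    (f : V -> R) (x v : V) (a b : R) :
  is_derive (f x) 1 h a -> is_derive x v f b ->
  is_derive x v (fun y => h (f y)) (a * b).
Proof.
have line (g : V -> R) c : is_derive x v g c <->
    is_derive (0 : R) 1 (fun t : R => g (t *: v + x)) c.
  have lineE : 'D_v g x = 'D_1 (fun t : R => g (t *: v + x)) (0 : R).
    rewrite /derive; set q1 := fun _ => _; set q2 := fun _ => _.
    suff -> : q1 = q2 by []; apply/funext => t; rewrite /q1 /q2 /=.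
    by rewrite addr0 scale0r add0r [_%:A]mulr1.
  split=> -[dg <-].
    apply: (@DeriveDef _ _ _ _ _ (fun t : R => g (t *: v + x)));
      last by rewrite lineE.
    exact: (derivable1P _ _ _).1.
  apply: (@DeriveDef _ _ _ _ _ g); last by rewrite lineE.
  exact: (derivable1P _ _ _).2.
move=> dh /line df; apply/line.
by apply: (@is_derive1_comp _ h (fun t : R => f (t *: v + x)));
  rewrite /= ?scale0r ?add0r.
Qed.

(** * Functions of class C^k on an open subset of R^n *)

Section ClassC.
Variables (R : realType) (n : nat).
Implicit Types (U V : set 'rV[R]_n) (f g : 'rV[R]_n -> R) (k : nat).

Lemma class_C_continuous k U f : class_C k U f ->
  forall x, U x -> {for x, continuous f}.
Proof. by case: k => [|k] [fc _]. Qed.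

Lemma class_CS k U f : class_C k.+1 U f -> class_C k U f.
Proof.
elim: k f => [|k IH] f [fc df]; split=> // i.
by have [fd /IH] := df i.
Qed.

Lemma class_C_local k U f :
  (forall x, U x -> exists2 V, V x & class_C k V f) -> class_C k U f.
Proof.
elim: k f => [|k IH] f Uf.
  by split=> // x /Uf[V Vx [fc _]]; exact: fc.
split=> [x /Uf[V Vx [fc _]]|i]; first exact: fc.
split=> [x /Uf[V Vx [_ /(_ i) [dx _]]]|]; first exact: dx.
by apply: IH => x /Uf[V Vx [_ /(_ i) [_ ?]]]; exists V.
Qed.

Lemma class_C_eq k U f g : open U -> (forall x, U x -> f x = g x) ->
  class_C k U f -> class_C k U g.
Proof.
move=> oU; elim: k f g => [|k IH] f g fg.
all: have nfg x : U x -> \forall y \near x, f y = g y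
  by move=> Ux; apply: filterS fg _; exact: open_nbhs_nbhs.
all: have fgc x : U x -> {for x, continuous f} -> {for x, continuous g}
  by move=> Ux; rewrite /prop_for /continuous_at -(fg _ Ux) => fc;
     exact: cvg_trans (near_eq_cvg (nfg _ Ux)) fc.
  by case=> fc _; split=> // x Ux; exact/fgc/fc.
case=> fc df; split=> [x Ux|i]; first exact/fgc/fc.
have [fd Df] := df i; split=> [x Ux|].
  exact: near_eq_derivable (nfg _ Ux) (fd _ Ux).
apply: IH Df => x Ux; exact/near_eq_derive/nfg.
Qed.

Lemma class_C_cst k U (a : R) : class_C k U (fun=> a).
Proof.
elim: k a => [|k IH] a;
  (split; first by move=> x _; exact: cst_continuous) => // i.
split=> [x _|]; first exact: derivable_cst.
have -> : (fun x : 'rV[R]_n => 'D_(delta_mx 0 i) (fun=> a) x) = fun=> 0.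
  by apply/funext => x; rewrite derive_cst.
exact: IH.
Qed.

Section Closure.
Variable U : set 'rV[R]_n.
Hypothesis oU : open U.

Lemma class_CD k f g : class_C k U f -> class_C k U g ->
  class_C k U (fun x => f x + g x).
Proof.
elim: k f g => [|k IH] f g [fc df] [gc dg].
all: (split; first by move=> x Ux; exact: (continuousD (fc _ Ux) (gc _ Ux))).
  by [].
move=> i.
have [fd Df] := df i; have [gd Dg] := dg i; split=> [x Ux|].
  by apply: derivableD; [exact: fd|exact: gd].
apply: class_C_eq (IH _ _ Df Dg) => // x Ux.
by rewrite -[RHS]/('D__ (f + g) x) deriveD //; [exact: fd|exact: gd].
Qed.

Lemma class_CM k f g : class_C k U f -> class_C k U g ->
  class_C k U (fun x => f x * g x).
Proof.
elim: k f g => [|k IH] f g Cf Cg; have [fc df] := Cf; have [gc dg] := Cg.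
  by split=> // x Ux; exact: (continuousM (fc _ Ux) (gc _ Ux)).
split=> [x Ux|i]; first by exact: (continuousM (fc _ Ux) (gc _ Ux)).
have [fd Df] := df i; have [gd Dg] := dg i; split=> [x Ux|].
  by apply: derivableM; [exact: fd|exact: gd].
apply: class_C_eq (class_CD (IH _ _ (class_CS Cf) Dg) (IH _ _ (class_CS Cg)
  Df)) => //.
move=> x Ux; rewrite -[RHS]/('D__ (f * g) x) deriveM //; [exact: fd|exact: gd].
Qed.

Lemma class_CV k f : (forall x, U x -> f x != 0) -> class_C k U f ->
  class_C k U (fun x => (f x)^-1).
Proof.
move=> f0; elim: k f f0 => [|k IH] f f0 Cf; have [fc df] := Cf.
  by split=> // x Ux; exact: (continuousV (f0 _ Ux) (fc _ Ux)).
split=> [x Ux|i]; first by exact: (continuousV (f0 _ Ux) (fc _ Ux)).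
have [fd Df] := df i; split=> [x Ux|].
  by apply: derivableV; [exact: f0|exact: fd].
have fV := IH _ f0 (class_CS Cf).
apply: class_C_eq (class_CM (class_CM (class_C_cst k U (-1)) (class_CM fV fV))
  Df) => //.
move=> x Ux; rewrite deriveV ?f0 ?fd //; last exact: fd.
by rewrite /GRing.scale /= expr2 invfM mulN1r.
Qed.

Lemma class_C_flat k l f : class_C k U f -> class_C k U (fun x => flat l (f x)).
Proof.
have flat_cont m x : {for x, continuous f} ->
    {for x, continuous (fun x => flat m (f x))}.
  move=> fc; apply: (@continuous_comp _ _ _ f (flat m)) => //.
  apply/differentiable_continuous/derivable1_diffP.
  by have [] := is_derive_flat m (f x).
elim: k l f flat_cont => [|k IH] l f flat_cont Cf; have [fc df] := Cf.
  by split=> // x Ux; exact/flat_cont/fc.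
split=> [x Ux|i]; first exact/flat_cont/fc.
have [fd Df] := df i; set v := delta_mx _ _ in fd Df *.
have chain x : U x -> is_derive x v (fun x => flat l (f x))
    ((flat l.+2 (f x) - l%:R * flat l.+1 (f x)) * 'D_v f x).
  by move=> Ux; apply: is_derive_comp1;
    [exact: is_derive_flat | exact/derivableP/fd].
split=> [x /chain []//|].
apply: class_C_eq (class_CM (class_CD (IH l.+2 f flat_cont (class_CS Cf))
  (class_CM (class_C_cst k U (- l%:R)) (IH l.+1 f flat_cont (class_CS Cf))))
    Df) => //.
by move=> x /chain []; rewrite mulNr => _ ->.
Qed.

End Closure.
End ClassC.

(** * Smooth functions on a manifold *)

Section SmoothFunctions.
Variables (R : realType) (n : nat) (M : manifold R n).
Implicit Types (U V : set M) (f g : M -> R).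

Lemma chart_image_open (c : chart R n M) U : open U -> open (chart_image c U).
Proof.
move=> oU; rewrite openE => x [cx Ux].
rewrite /interior; apply: filterI.
  by apply: open_nbhs_nbhs; split=> //; exact: chart_cod_open.
by apply: (chart_inv_continuous cx); exact: open_nbhs_nbhs.
Qed.

Lemma smooth_on_eq U f g : open U -> (forall p, U p -> f p = g p) ->
  smooth_on U f -> smooth_on U g.
Proof.
move=> oU fg sf c ac k; apply: class_C_eq (sf c ac k) => [|x [_ /fg]//].
exact: chart_image_open.
Qed.

(** Smoothness is a local property, so that functions may be glued along an open
    cover. *)
Lemma smooth_on_local U f :
  (forall p, U p -> exists2 V, V p & smooth_on V f) -> smooth_on U f.
Proof.
move=> Uf c ac k; apply: class_C_local => x [cx /Uf[V Vx sf]].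
by exists (chart_image c V) => //; exact: sf.
Qed.

Lemma smooth_on_sub U V f : V `<=` U -> smooth_on U f -> smooth_on V f.
Proof. by move=> VU sf; apply: smooth_on_local => p /VU Up; exists U. Qed.

Lemma smooth_smooth_on U f : smooth f -> smooth_on U f.
Proof. exact: smooth_on_sub. Qed.

Lemma smooth_on_cst U (a : R) : smooth_on U (fun=> a).
Proof. by move=> c _ k; exact: class_C_cst. Qed.

Lemma smooth_on_continuous U f p : U p -> smooth_on U f ->
  {for p, continuous f}.
Proof.
move=> Up sf; have [c ac cp] := atlas_cover p.
have xp : chart_image c U (chart_map c p).
  by split; [exact: chart_mapP | rewrite chart_mapK].
have fc := class_C_continuous (sf c ac 0%N) xp.
have : {for p, continuous ((fun x => f (chart_inv c x)) \o chart_map c)}.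
  by apply: continuous_comp => //; exact: chart_map_continuous.
rewrite /prop_for /continuous_at /= chart_mapK //; apply: cvg_trans.
apply: near_eq_cvg; apply: (@filterS _ _ _ (chart_dom c)); last first.
  by apply: open_nbhs_nbhs; split=> //; exact: chart_dom_open.
by move=> q cq; rewrite /= chart_mapK.
Qed.

Section Open.
Variable U : set M.
Hypothesis oU : open U.

Lemma smooth_onD f g : smooth_on U f -> smooth_on U g ->
  smooth_on U (fun p => f p + g p).
Proof.
by move=> sf sg c ac k; apply: class_CD;
  [exact: chart_image_open|exact: sf|exact: sg].
Qed.

Lemma smooth_onM f g : smooth_on U f -> smooth_on U g ->
  smooth_on U (fun p => f p * g p).
Proof.
by move=> sf sg c ac k; apply: class_CM;
  [exact: chart_image_open|exact: sf|exact: sg].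
Qed.

Lemma smooth_onN f : smooth_on U f -> smooth_on U (fun p => - f p).
Proof.
move=> sf; apply: smooth_on_eq (smooth_onM (smooth_on_cst U (-1)) sf) => // p _.
by rewrite mulN1r.
Qed.

Lemma smooth_onB f g : smooth_on U f -> smooth_on U g ->
  smooth_on U (fun p => f p - g p).
Proof. by move=> sf sg; apply: smooth_onD => //; exact: smooth_onN. Qed.

Lemma smooth_onV f : (forall p, U p -> f p != 0) -> smooth_on U f ->
  smooth_on U (fun p => (f p)^-1).
Proof.
move=> f0 sf c ac k; apply: class_CV; [exact: chart_image_open| |exact: sf].
by move=> x [_ /f0].
Qed.

Lemma smooth_on_flat l f : smooth_on U f -> smooth_on U (fun p => flat l (f p)).
Proof.
by move=> sf c ac k; apply: class_C_flat; [exact: chart_image_open|exact: sf].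
Qed.

Lemma smooth_on_sum I (r : seq I) (P : pred I) (F : I -> M -> R) :
  (forall i, P i -> smooth_on U (F i)) ->
  smooth_on U (fun p => \sum_(i <- r | P i) F i p).
Proof.
move=> sF; rewrite (_ : (fun p => _) = \sum_(i <- r | P i) F i).
  by elim/big_ind: _ => //; [exact: smooth_on_cst | exact: smooth_onD].
by apply/funext => p; rewrite fct_sumE.
Qed.

Lemma smooth_on_prod I (r : seq I) (P : pred I) (F : I -> M -> R) :
  (forall i, P i -> smooth_on U (F i)) ->
  smooth_on U (fun p => \prod_(i <- r | P i) F i p).
Proof.
move=> sF; rewrite (_ : (fun p => _) = \prod_(i <- r | P i) F i).
  by elim/big_ind: _ => //; [exact: smooth_on_cst | exact: smooth_onM].
by apply/funext => p; rewrite fct_prodE.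
Qed.

Lemma smooth_on_det m (A : M -> 'M[R]_m) :
  (forall i j, smooth_on U (fun p => A p i j)) ->
  smooth_on U (fun p => \det (A p)).
Proof.
move=> sA; apply: smooth_on_sum => s _; apply: smooth_onM.
  exact: smooth_on_cst.
by apply: smooth_on_prod.
Qed.

(** Cramer's rule keeps the solution of a linear system smooth. *)
Lemma smooth_on_invmx m (A : M -> 'M[R]_m) :
  (forall p, U p -> A p \in unitmx) ->
  (forall i j, smooth_on U (fun p => A p i j)) ->
  forall i j, smooth_on U (fun p => invmx (A p) i j).
Proof.
move=> uA sA i j.
have sadj : smooth_on U (fun p => (\det (A p))^-1 * \adj (A p) i j).
  apply: smooth_onM; first apply: smooth_onV; last 1 first.
  - have -> : (fun p => \adj (A p) i j) =
        fun p => (-1) ^+ (j + i) * \det (row' j (col' i (A p))).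
      by apply/funext => p; rewrite mxE.
    apply: smooth_onM; first exact: smooth_on_cst.
    apply: smooth_on_det => k l.
    have -> : (fun p => row' j (col' i (A p)) k l) =
        fun p => A p (lift j k) (lift i l) by apply/funext => p; rewrite !mxE.
    exact: sA.
  - by move=> p /uA; rewrite unitmxE unitfE.
  - exact: smooth_on_det.
apply: smooth_on_eq sadj => // p /uA uAp.
by rewrite /invmx uAp [RHS]mxE.
Qed.

Lemma smooth_on_mulmx m k l (A : M -> 'M[R]_(m, k)) (B : M -> 'M[R]_(k, l)) :
  (forall i j, smooth_on U (fun p => A p i j)) ->
  (forall i j, smooth_on U (fun p => B p i j)) ->
  forall i j, smooth_on U (fun p => (A p *m B p) i j).
Proof.
move=> sA sB i j.
have -> : (fun p => (A p *m B p) i j) = fun p => \sum_h A p i h * B p h j.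
  by apply/funext => p; rewrite mxE.
by apply: smooth_on_sum => h _; apply: smooth_onM.
Qed.
End Open.

Lemma smooth_openN0 U f : open U -> smooth_on U f ->
  open (U `&` [set p | f p != 0]).
Proof.
move=> oU sf; rewrite openE => p [Up fp0]; rewrite /interior.
apply: filterI; first exact: open_nbhs_nbhs.
apply: (smooth_on_continuous Up sf (t := [set x : R | x != 0]));
  apply: open_nbhs_nbhs.
by split=> //; exact: open_neq.
Qed.

Lemma smooth_on_chart_coord (c : chart R n M) (j : 'I_n) : atlas c ->
  smooth_on (chart_dom c) (fun p => chart_map c p 0 j).
Proof. by move=> ac d ad k; exact: atlas_compatible. Qed.

(** In a chart the bump is a product, over the coordinates, of flat functions
    that vanish off a small box.  The box is compact, hence closed in the
    Hausdorff space [M], so that the extension by [0] stays smooth. *)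
Lemma bump_function_neq0 U p : open U -> U p ->
  exists (phi : M -> R) (K : set M),
    [/\ smooth phi, phi p != 0, closed K, K `<=` U
      & forall q, ~ K q -> phi q = 0].
Proof.
move=> oU Up; have [c ac cp] := atlas_cover p.
set x0 := chart_map c p.
have Ux0 : chart_image c U x0.
  by split; [exact: chart_mapP | rewrite chart_mapK].
have /nbhs_ballP[e e0 eU] : nbhs x0 (chart_image c U).
  by apply: open_nbhs_nbhs; split=> //; exact: chart_image_open.
have [r r0 re] : exists2 r, 0 < r & r < e.
  by exists (e / 2); rewrite ?divr_gt0 // ltr_pdivrMr // ltr_pMr // ltr1n.
pose B : set 'rV[R]_n :=
  [set x | forall j, `[x0 0 j - r, x0 0 j + r]%classic (x 0 j)].
have cB : compact B.
  by apply: (@rV_compact _ _ (fun j => `[x0 0 j - r, x0 0 j + r]%classic)) => j;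
    exact: segment_compact.
have BU : B `<=` chart_image c U.
  move=> x Bx; apply: eU; split=> // i j; rewrite ord1 /ball /=.
  have := Bx j; rewrite /= in_itv /= => /andP[h1 h2].
  by rewrite distrC ltr_distl; apply/andP; split; lra.
pose K := chart_inv c @` B.
have cK : closed K.
  apply: compact_closed; first exact: manifold_hausdorff.
  apply: continuous_compact cB.
  apply: continuous_in_subspaceT => x /set_mem /BU[cx _].
  exact: chart_inv_continuous.
have Kc q : K q -> chart_dom c q by move=> [x /BU[cx _] <-]; exact: chart_invP.
pose psi q := \prod_j (flat 0 (r - (chart_map c q 0 j - x0 0 j)) *
                       flat 0 (r + (chart_map c q 0 j - x0 0 j))).
pose phi q := if `[< chart_dom c q >] then psi q else 0.
have phi0 q : ~ K q -> phi q = 0.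
  move=> Kq; rewrite /phi; case: asboolP => // cq; apply: contrapT => psi0;
    apply: Kq.
  exists (chart_map c q); last exact: chart_mapK.
  move=> j; rewrite /= in_itv /=; apply/andP; split; rewrite leNgt;
    apply/negP => h;
    apply: psi0; rewrite /psi (bigD1 j) //=.
    by rewrite (@flat_le0 _ _ (r + (_ - _))) ?mulr0 ?mul0r //; lra.
  by rewrite flat_le0 ?mul0r //; lra.
have oc : open (chart_dom c) by exact: chart_dom_open.
exists phi, K; split=> //.
- apply: smooth_on_local => q _; have [Kq|Kq] := pselect (K q); last first.
    exists (~` K) => //; apply: smooth_on_eq (smooth_on_cst _ 0).
      exact: closed_openC.
    by move=> s /phi0 ->.
  exists (chart_dom c); first exact: Kc.
  apply: (@smooth_on_eq _ psi) => // [s cs|]; first by rewrite /phi asboolT.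
  apply: smooth_on_prod => // j _.
  have sc := smooth_on_chart_coord j ac.
  have scx := smooth_onB oc sc (smooth_on_cst _ (x0 0 j)).
  apply: smooth_onM => //; apply: smooth_on_flat => //.
    exact: smooth_onB (smooth_on_cst _ r) scx.
  exact: smooth_onD (smooth_on_cst _ r) scx.
- rewrite /phi asboolT // gt_eqF //; apply: prodr_gt0 => j _.
  by rewrite -/x0 subrr subr0 addr0 mulr_gt0 ?flat_gt0.
- by move=> q [x /BU[_ Ux] <-].
Qed.

(** The quotient [flat t / (flat t + flat (1 - t))] is a smooth step, which is
    [0] for [t <= 0] and [1] for [t >= 1]; it flattens the top of a bump. *)
Lemma bump_function U p : open U -> U p ->
  exists (phi : M -> R) (V K : set M),
    [/\ smooth phi, open V /\ V p, forall q, V q -> phi q = 1,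
      closed K /\ K `<=` U
      & forall q, ~ K q -> phi q = 0].
Proof.
move=> oU Up; have [psi [K [spsi psip0 cK KU psi0]]] :=
  bump_function_neq0 oU Up.
have oT : open [set: M] by exact: openT.
(* [t] is 2 at [p] and -2 wherever [psi] vanishes. *)
pose t q := psi q * psi q * (4 * (psi p * psi p)^-1) - 2.
have tp : t p = 2 by rewrite /t; field.
have st : smooth t.
  apply: smooth_onB => //; last exact: smooth_on_cst.
  by apply: smooth_onM => //; [exact: smooth_onM|exact: smooth_on_cst].
have d0 q : 0 < flat 0 (t q) + flat 0 (1 - t q).
  have flat_ge0 s : 0 <= flat 0 s :> R.
    by have [/(flat_gt0 0%N)/ltW|/(flat_le0 0%N) ->] := ltP 0 s.
  have [t0|t0] := ltP 0 (t q); first by rewrite ltr_pwDl ?flat_gt0.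
  by rewrite ltr_wpDl // flat_gt0 //; lra.
exists (fun q => flat 0 (t q) * (flat 0 (t q) + flat 0 (1 - t q))^-1).
exists (t @^-1` [set s : R | 1 < s]), K; split=> //.
- have sF : smooth (fun q => flat 0 (t q)) by exact: smooth_on_flat.
  have sG : smooth (fun q => flat 0 (1 - t q)).
    by apply: smooth_on_flat => //; apply: smooth_onB => //;
      exact: smooth_on_cst.
  apply: smooth_onM => //; apply: smooth_onV => //; last exact: smooth_onD.
  by move=> q _; rewrite gt_eqF.
- split; last by rewrite /= tp ltr1n.
  apply: open_comp; last exact: open_gt.
  by move=> q _; exact: (smooth_on_continuous (U := setT)).
- move=> q /= t1; rewrite (@flat_le0 _ _ (1 - t q)) ?addr0 ?divff //;
  last by lra.
  by rewrite gt_eqF // flat_gt0 //; lra.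
- by move=> q /psi0 psiq; rewrite flat_le0 ?mul0r // /t psiq; lra.
Qed.

(** The product vanishes off the closed set [K], and [U] and the complement of
    [K] cover [M]. *)
Lemma smooth_bumpM U (phi g : M -> R) (K : set M) :
  open U -> smooth phi -> closed K -> K `<=` U ->
  (forall q, ~ K q -> phi q = 0) -> smooth_on U g ->
  smooth (fun q => phi q * g q).
Proof.
move=> oU sphi cK KU phi0 sg; apply: smooth_on_local => q _.
have [Kq|Kq] := pselect (K q).
  by exists U; [exact: KU | apply: smooth_onM => //; exact: smooth_smooth_on].
exists (~` K) => //; apply: smooth_on_eq (smooth_on_cst _ 0).
  exact: closed_openC.
by move=> s /phi0 ->; rewrite mul0r.
Qed.

End SmoothFunctions.

(** * Tangent vectors, vector fields and brackets *)

Section TangentVectors.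
Variables (R : realType) (n : nat) (M : manifold R n).
Implicit Types (p q : M) (f g : M -> R) (u v : tvec M) (X Y Z : vfield M).
Implicit Types (U V : set M).

Lemma tangent0 p : tangent p (0 : tvec M).
Proof.
by split=> [a f g _ _|f g _ _|f _] //; rewrite /= !fctE ?mulr0 ?addr0.
Qed.

Lemma tangentP p a u v : tangent p u -> tangent p v -> tangent p (a *: u + v).
Proof.
move=> [ul um u0] [vl vm v0]; split=> [b f g sf sg|f g sf sg|f nsf].
- rewrite !fctE ul // vl // /GRing.scale /=; ring.
- rewrite !fctE um // vm // /GRing.scale /=; ring.
- by rewrite !fctE u0 // v0 // scaler0 addr0.
Qed.

Lemma tangentZ p a u : tangent p u -> tangent p (a *: u).
Proof.
by move=> tu; rewrite -[a *: u]addr0; apply: tangentP => //; exact: tangent0.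
Qed.

Lemma tangentD p u v : tangent p u -> tangent p v -> tangent p (u + v).
Proof. by move=> tu tv; rewrite -[u]scale1r; exact: tangentP. Qed.

Lemma tangent_sum p I (r : seq I) (P : pred I) (v : I -> tvec M) :
  (forall i, P i -> tangent p (v i)) -> tangent p (\sum_(i <- r | P i) v i).
Proof.
by move=> tv; elim/big_ind: _ => //; [exact: tangent0|exact: tangentD].
Qed.

Section Derivation.
Variables (p : M) (v : tvec M).
Hypothesis tv : tangent p v.

Lemma tangent_fD f g : smooth f -> smooth g ->
  v (fun q => f q + g q) = v f + v g.
Proof.
move=> sf sg; have [vl _ _] := tv; have := vl 1 f g sf sg.
by rewrite scale1r mul1r.
Qed.

Lemma tangent_f0 : v (fun=> 0) = 0.
Proof.
have := tangent_fD (smooth_on_cst _ _) (smooth_on_cst _ _)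
  : v (fun=> 0 + 0) = v (fun=> 0) + v (fun=> 0).
by rewrite addr0 => /eqP; rewrite -subr_eq0 opprD addNKr oppr_eq0 => /eqP.
Qed.

Lemma tangent_fZ a f : smooth f -> v (fun q => a * f q) = a * v f.
Proof.
move=> sf; have [vl _ _] := tv; have := vl a f (fun=> 0) sf (smooth_on_cst _ _).
by rewrite tangent_f0 !addr0 => <-.
Qed.

Lemma tangent_fM f g : smooth f -> smooth g ->
  v (fun q => f q * g q) = f p * v g + g p * v f.
Proof. by move=> sf sg; have [_ vm _] := tv; exact: vm. Qed.

Lemma tangent_fsum I (r : seq I) (F : I -> M -> R) : (forall i, smooth (F i)) ->
  v (fun q => \sum_(i <- r) F i q) = \sum_(i <- r) v (F i).
Proof.
move=> sF; elim: r => [|i r IH].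
  rewrite big_nil -[RHS]tangent_f0; congr v; apply/funext => q; exact: big_nil.
rewrite big_cons -IH -tangent_fD //; last first.
  by apply: smooth_on_sum => [|j _]; [exact: openT|exact: sF].
by congr v; apply/funext => q; exact: big_cons.
Qed.

End Derivation.

Lemma field_tangent X p : vector_fields X -> tangent p (X p).
Proof. by case=> tX _; exact: tX. Qed.

(** For a function that is not smooth this is [0], by the convention on tangent
    vectors. *)
Lemma smooth_field_app U X f : open U -> smooth_field_on U X ->
  smooth_on U (fun q => X q f).
Proof.
move=> oU [tX sX]; have [/sX//|nsf] := pselect (smooth f).
apply: smooth_on_eq (smooth_on_cst _ 0) => // q /tX [_ _ ->] //.
Qed.

Lemma field_app X f : vector_fields X -> smooth (fun q => X q f).
Proof. by apply: smooth_field_app; exact: openT. Qed.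

Lemma smooth_field_local U X :
  (forall p, U p -> exists2 V, V p & smooth_field_on V X) ->
    smooth_field_on U X.
Proof.
move=> lX; split=> [p /lX[V Vp [tX _]]|f sf]; first exact: tX.
by apply: smooth_on_local => p /lX[V Vp [_ sX]]; exists V => //; exact: sX.
Qed.

Lemma smooth_field_eq U X Y : open U -> (forall p, U p -> X p = Y p) ->
  smooth_field_on U X -> smooth_field_on U Y.
Proof.
move=> oU XY [tX sX]; split=> [p Up|f sf]; first by rewrite -XY //; exact: tX.
by apply: smooth_on_eq (sX f sf) => // p /XY ->.
Qed.

Lemma smooth_field_sub U X : vector_fields X -> smooth_field_on U X.
Proof. by move=> sX; apply: smooth_field_local => p _; exists setT. Qed.

Lemma smooth_field_sumZ U I (r : seq I) (P : pred I) (a : I -> M -> R)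
    (F : I -> vfield M) : open U ->
  (forall i, P i -> smooth_on U (a i)) ->
  (forall i, P i -> smooth_field_on U (F i)) ->
  smooth_field_on U (fun q => \sum_(i <- r | P i) a i q *: F i q).
Proof.
move=> oU sa sF; split=> [p Up|f sf].
  by apply: tangent_sum => i Pi; apply: tangentZ; have [tF _] := sF i Pi;
    exact: tF.
have -> : (fun p => (\sum_(i <- r | P i) a i p *: F i p) f) =
    fun p => \sum_(i <- r | P i) a i p * F i p f.
  by apply/funext => p; rewrite fct_sumE.
apply: smooth_on_sum => // i Pi; apply: smooth_onM => //; first exact: sa.
by have [_ sFi] := sF i Pi; exact: sFi.
Qed.

Lemma vector_fieldsP a X Y : vector_fields X -> vector_fields Y ->
  vector_fields (a *: X + Y).
Proof.
move=> vX vY; split=> [p _|f sf].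
  by apply: tangentP; exact: field_tangent.
apply: smooth_onD; [exact: openT| |exact: field_app].
by apply: smooth_onM; [exact: openT|exact: smooth_on_cst|exact: field_app].
Qed.

Lemma vector_fieldsD X Y : vector_fields X -> vector_fields Y ->
  vector_fields (X + Y).
Proof. by move=> vX vY; rewrite -[X]scale1r; exact: vector_fieldsP. Qed.

Lemma vector_fieldsB X Y : vector_fields X -> vector_fields Y ->
  vector_fields (X - Y).
Proof. by move=> vX vY; rewrite addrC -scaleN1r; exact: vector_fieldsP. Qed.

Lemma vector_fields0 : vector_fields (0 : vfield M).
Proof.
by split=> [p _|f _]; [exact: tangent0|exact: smooth_on_cst].
Qed.

Lemma vector_fields_bump U X (phi : M -> R) (K : set M) :
  open U -> smooth phi -> closed K -> K `<=` U ->
  (forall q, ~ K q -> phi q = 0) ->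
  smooth_field_on U X -> vector_fields (fun q => phi q *: X q).
Proof.
move=> oU sphi cK KU phi0 [tX sX]; split=> [p _|f sf].
  have [/KU Up|/phi0 ->] := pselect (K p); first exact/tangentZ/tX.
  by rewrite scale0r; exact: tangent0.
exact: (smooth_bumpM oU sphi cK KU phi0 (sX f sf)).
Qed.

Lemma bracket_vector_fields X Y : vector_fields X -> vector_fields Y ->
  vector_fields (bracket X Y).
Proof.
move=> vX vY; have oT : open [set: M] by exact: openT.
split=> [p _|f sf]; last first.
  by apply: smooth_onB => //; apply: field_app.
split=> [a f g sf sg|f g sf sg|f nsf]; rewrite /bracket.
- have lin Z : vector_fields Z ->
      (fun q => Z q (a *: f + g)) = fun q => a * Z q f + Z q g.
    by move=> vZ; apply/funext => q; have [-> //] := field_tangent q vZ.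
  have app Z W : vector_fields Z -> vector_fields W ->
      W p (fun q => a * Z q f + Z q g) =
      a * W p (fun q => Z q f) + W p (fun q => Z q g).
    move=> vZ vW; have tW := field_tangent p vW.
    rewrite (tangent_fD tW) ?(tangent_fZ tW) //; try exact: field_app.
    by apply: smooth_onM => //; [exact: smooth_on_cst|exact: field_app].
  by rewrite !lin // !app //; ring.
- have leib Z : vector_fields Z ->
      (fun q => Z q (f * g)) = fun q => f q * Z q g + g q * Z q f.
    by move=> vZ; apply/funext => q; have [_ -> //] := field_tangent q vZ.
  have app Z W : vector_fields Z -> vector_fields W ->
      W p (fun q => f q * Z q g + g q * Z q f) =
      f p * W p (fun q => Z q g) + Z p g * W p f +
      (g p * W p (fun q => Z q f) + Z p f * W p g).
    move=> vZ vW; have tW := field_tangent p vW.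
    have sZ h : smooth (fun q => Z q h) by exact: field_app.
    rewrite (tangent_fD tW).
    - by rewrite (tangent_fM tW (f := f)) // (tangent_fM tW (f := g)).
    - exact: (smooth_onM oT sf (sZ g)).
    - exact: (smooth_onM oT sg (sZ f)).
  by rewrite !leib // !app //; ring.
- have zero Z : vector_fields Z -> (fun q => Z q f) = fun=> 0.
    by move=> vZ; apply/funext => q; have [_ _ ->] := field_tangent q vZ.
  by rewrite !zero // !(tangent_f0 (field_tangent p _)) // subr0.
Qed.

Lemma bracketC X Y p : bracket X Y p = - bracket Y X p.
Proof. by apply/funext => f; rewrite /bracket !fctE opprB. Qed.

Lemma bracketPl a X Y Z p : vector_fields X ->
  vector_fields Y -> vector_fields Z ->
  bracket (a *: X + Y) Z p = a *: bracket X Z p + bracket Y Z p.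
Proof.
move=> vX vY vZ; apply/funext => f; have tZ := field_tangent p vZ.
have sX := field_app f vX; have sY := field_app f vY.
rewrite /bracket !fctE (tangent_fD tZ) ?(tangent_fZ tZ) //.
  by rewrite /GRing.scale /=; ring.
by apply: smooth_onM => //; [exact: openT|exact: smooth_on_cst].
Qed.

Lemma bracketDl X Y Z p : vector_fields X ->
  vector_fields Y -> vector_fields Z ->
  bracket (X + Y) Z p = bracket X Z p + bracket Y Z p.
Proof.
by move=> vX vY vZ; have := bracketPl 1 p vX vY vZ; rewrite !scale1r.
Qed.

Lemma bracketBl X Y Z p : vector_fields X ->
  vector_fields Y -> vector_fields Z ->
  bracket (X - Y) Z p = bracket X Z p - bracket Y Z p.
Proof.
move=> vX vY vZ; have := bracketPl (-1) p vY vX vZ.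
by rewrite !scaleN1r addrC [RHS]addrC.
Qed.

(** The bracket is a differential operator of order one in its first argument,
    with symbol along [X]: modulo [X p] it is linear over functions. *)
Lemma bracketMl (psi : M -> R) X Y p : smooth psi ->
  vector_fields X -> vector_fields Y ->
  bracket (fun q => psi q *: X q) Y p = psi p *: bracket X Y p - Y p psi *: X p.
Proof.
move=> spsi vX vY; apply/funext => f; have tY := field_tangent p vY.
rewrite /bracket !fctE.
rewrite (tangent_fM tY (f := psi) (g := fun q => X q f)) //;
  last exact: field_app.
by rewrite /GRing.scale /=; ring.
Qed.

Lemma bracket_suml I (r : seq I) (P : pred I) (a : I -> R)
    (F : I -> vfield M) Z p :
  (forall i, P i -> vector_fields (F i)) -> vector_fields Z ->
  bracket (fun q => \sum_(i <- r | P i) a i *: F i q) Z p =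
  \sum_(i <- r | P i) a i *: bracket (F i) Z p.
Proof.
move=> vF vZ.
have -> : (fun q => \sum_(i <- r | P i) a i *: F i q) =
    \sum_(i <- r | P i) a i *: F i.
  apply/funext => q.
  by rewrite (big_morph (fun X : vfield M => X q) (id1 := 0) (op1 := +%R)).
have bracket0 : bracket 0 Z p = 0.
  apply/funext => f; rewrite -[LHS]/(0 - Z p (fun=> 0)).
  by rewrite (tangent_f0 (field_tangent p vZ)) subr0.
suff [] : vector_fields (\sum_(i <- r | P i) a i *: F i) /\
  bracket (\sum_(i <- r | P i) a i *: F i) Z p =
  \sum_(i <- r | P i) a i *: bracket (F i) Z p by [].
apply: (big_ind2 (fun X v => vector_fields X /\ bracket X Z p = v)).
- by split=> //; exact: vector_fields0.
- move=> X u Y v [vX <-] [vY <-]; split; first exact: vector_fieldsD.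
  exact: bracketDl.
- move=> i Pi; have v0 := vector_fields0; split.
    by rewrite -[_ *: _]addr0; apply: vector_fieldsP => //; exact: vF.
  have := bracketPl (a i) p (vF i Pi) v0 vZ.
  by rewrite bracket0 !addr0.
Qed.

End TangentVectors.

(** * Independent functionals and evaluation *)

Section EvaluationMatrix.
Variables (F : fieldType) (T : Type) (n : nat).
Implicit Types (v : 'I_n -> T -> F).

(** As long as the rows of evaluations do not span, some vector [c] kills them
    all; independence provides a point where the combination [c] of the
    functionals does not vanish, and the evaluation there raises the rank. *)
Lemma independent_eval v :
  (forall c : 'I_n -> F, (forall t, \sum_i c i * v i t = 0) ->
    forall i, c i = 0) ->
  exists t : 'I_n -> T, \matrix_(i, j) v i (t j) \in unitmx.
Proof.
move=> v_free; pose A m (t : 'I_m -> T) := \matrix_(i < m, j < n) v j (t i).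
have rank_ge k : (k <= n)%N -> exists m (t : 'I_m -> T), (k <= \rank (A m t))%N.
  elim: k => [_|k IH kn].
    exists 0%N.
    by exists (fun i : 'I_0 => let: Ordinal _ h := i in False_rect T (notF h)).
  have [m [t rt]] := IH (ltnW kn).
  have [|le_rk] := ltnP k (\rank (A m t)); first by exists m, t.
  have coker0 : cokermx (A m t) != 0.
    by rewrite -mxrank_eq0 mxrank_coker subn_eq0 -ltnNge;
      exact: leq_ltn_trans le_rk kn.
  have [i [j cij]] : exists i j, cokermx (A m t) i j != 0.
    apply: contrapT => h; move/eqP: coker0; apply; apply/matrixP => i j;
      rewrite [RHS]mxE.
    by apply: contrapT => /eqP cij; apply: h; exists i, j.
  (* some evaluation is not killed by a vector that kills all the rows *)
  have [t0 vt0] : exists t0, \sum_i cokermx (A m t) i j * v i t0 != 0.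
    apply: contrapT => h; move/eqP: cij; apply.
    apply: (v_free (fun i => cokermx (A m t) i j)) => t0.
    by apply: contrapT => /eqP ?; apply: h; exists t0.
  pose r : 'rV[F]_n := \row_l v l t0.
  exists (m + 1)%N, (fun i => if fintype.split i is inl i' then t i' else t0).
  have -> : A (m + 1)%N
      (fun i => if fintype.split i is inl i' then t i' else t0) =
      col_mx (A m t) r.
    by apply/matrixP => a b; rewrite !mxE; case: splitP => ? _; rewrite !mxE.
  apply: leq_ltn_trans rt _; apply: rank_ltmx.
  have sub : (A m t <= col_mx (A m t) r)%MS by rewrite -addsmxE addsmxSl.
  rewrite ltmxE sub col_mx_sub submx_refl /= submxE.
  apply/eqP => /matrixP /(_ 0 j); rewrite [RHS]mxE mxE => r0.
  move/eqP: vt0; apply; rewrite -[RHS]r0; apply: eq_bigr => l _.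
  by rewrite [in RHS]mxE mulrC.
have [m [t rt]] := rank_ge n (leqnn n).
have full : row_full (A m t) by rewrite /row_full eqn_leq rank_leq_col.
exists (fun j => t (fullrankfun full j)).
have := fullrowsub_unit full; rewrite -unitmx_tr; congr (_ \in unitmx).
by apply/matrixP => i j; rewrite !mxE.
Qed.

End EvaluationMatrix.

(** * Distributions of co-rank one and adapted frames *)

Section Distribution.
Variables (R : realType) (n : nat) (M : manifold R n) (C : M -> set (tvec M)).
Hypothesis hC : corank_one_distribution C.
Implicit Types (p q : M) (u v : tvec M) (X Y Z S : vfield M) (U V W : set M).

Lemma dist_tangent p u : C p u -> tangent p u.
Proof.
have [U [E [i0 [oU Up [sE _] CE]]]] := hC p.
rewrite CE // => -[a _ <-].
apply: tangent_sum => i _; apply: tangentZ; have [tE _] := sE i; exact: tE.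
Qed.

Lemma distP p a u v : C p u -> C p v -> C p (a *: u + v).
Proof.
have [U [E [i0 [oU Up _ CE]]]] := hC p.
rewrite CE //= => -[b b0 <-] [c c0 <-].
exists (a *: b + c); first by rewrite /= !mxE b0 c0 mulr0 addr0.
rewrite /combination scaler_sumr -big_split /=; apply: eq_bigr => i _.
by rewrite !mxE scalerDl scalerA.
Qed.

Lemma dist0 p : C p 0.
Proof.
have [U [E [i0 [oU Up _ CE]]]] := hC p.
rewrite CE //=; exists 0; rewrite /= ?mxE //.
by rewrite /combination big1 // => i _; rewrite mxE scale0r.
Qed.

Lemma distZ p a u : C p u -> C p (a *: u).
Proof.
by move=> Cu; rewrite -[a *: u]addr0; apply: distP => //; exact: dist0.
Qed.

Lemma distD p u v : C p u -> C p v -> C p (u + v).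
Proof. by move=> Cu Cv; rewrite -[u]scale1r; exact: distP. Qed.

Lemma distN p u : C p u -> C p (- u).
Proof. by move=> Cu; rewrite -scaleN1r; exact: distZ. Qed.

Lemma distB p u v : C p u -> C p v -> C p (u - v).
Proof. by move=> Cu Cv; apply: distD => //; exact: distN. Qed.

Lemma dist_subl p u v : C p (u - v) -> C p v -> C p u.
Proof. by move=> Cuv /(distD Cuv); rewrite subrK. Qed.

Lemma dist_trans p u v w : C p (u - v) -> C p (v - w) -> C p (u - w).
Proof. by move=> Cuv /(distD Cuv); rewrite subrKA. Qed.

Lemma dist_sum p I (r : seq I) (P : pred I) (u : I -> tvec M) :
  (forall i, P i -> C p (u i)) -> C p (\sum_(i <- r | P i) u i).
Proof. by move=> Cu; elim/big_ind: _ => //; [exact: dist0|exact: distD]. Qed.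

Lemma normal_class_eq p u v : normal_class C p u = normal_class C p v <->
  C p (u - v).
Proof.
split=> [/seteqP[uv _]|Cuv].
  by apply: uv; rewrite /normal_class /= subrr; exact: dist0.
apply/seteqP; split=> w /= h.
  by have := distD h Cuv; rewrite addrA subrK.
by have := distB h Cuv; rewrite opprB addrA subrK.
Qed.

Lemma sectionsB X Y : sections C X -> sections C Y -> sections C (X - Y).
Proof.
by move=> [vX CX] [vY CY]; split=> [|p]; [exact: vector_fieldsB|exact: distB].
Qed.

(** A frame of the tangent bundle over [W] made of globally defined fields, all
    of which but [F i0] are sections of the distribution; [omega] is the dual
    coframe, which is linear on all of [tvec M] since it is built from
    evaluations at functions. *)
Record adapted_frame (W : set M) (F : 'I_n -> vfield M) (i0 : 'I_n)
    (omega : 'I_n -> M -> tvec M -> R) : Prop := AdaptedFrame {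
  frame_open : open W;
  frame_field : forall i, vector_fields (F i);
  frame_section : forall i, i != i0 -> sections C (F i);
  coframeP : forall i q a u v,
    omega i q (a *: u + v) = a * omega i q u + omega i q v;
  coframe_dual : forall i j q, W q -> omega i q (F j q) = (i == j)%:R;
  coframe_expand : forall q v, W q -> tangent q v ->
    v = \sum_i omega i q v *: F i q;
  coframe_dist : forall q v, W q -> tangent q v -> C q v <-> omega i0 q v = 0;
  coframe_smooth : forall i X, vector_fields X ->
    smooth_on W (fun q => omega i q (X q)) }.

(** The members of a local frame become global fields when multiplied by a
    bump.  Being independent at [p], they are separated by [n] functions; near
    [p] the coframe is then obtained by inverting the matrix of the values of
    the frame at these functions. *)
Lemma adapted_frame_exists p : exists W F i0 omega,
  W p /\ adapted_frame W F i0 omega.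
Proof.
have [U [E [i0 [oU Up [sE frE] CE]]]] := hC p.
have [phi [V [K [sphi [oV Vp] phi1 [cK KU] phi0]]]] := bump_function oU Up.
have VU : V `<=` U.
  by move=> q /phi1 phiq; apply: KU; apply: contrapT => /phi0; rewrite phiq;
    exact/eqP/oner_neq0.
pose F i : vfield M := fun q => phi q *: E i q.
have FE i q : V q -> F i q = E i q.
  by move=> /phi1 phiq; rewrite /F phiq scale1r.
have vF i : vector_fields (F i).
  exact: (vector_fields_bump oU sphi cK KU phi0 (sE i)).
have [f Ap] : exists f : 'I_n -> M -> R, \matrix_(i, j) F i p (f j) \in unitmx.
  apply: (independent_eval (v := fun i f => F i p f)) => c c0 i.
  have [a [_ a_uniq]] := frE p Up 0 (tangent0 p).
  have c_comb : 0 = combination E (\row_i c i) p.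
    apply/funext => g; rewrite /combination fct_sumE -[LHS](c0 g).
    by apply: eq_bigr => k _; rewrite mxE FE.
  have z_comb : 0 = combination E 0 p.
    by rewrite /combination big1 // => k _; rewrite mxE scale0r.
  by have := a_uniq _ c_comb; rewrite (a_uniq _ z_comb) => /rowP /(_ i);
    rewrite !mxE.
pose A q := \matrix_(i, j) F i q (f j).
have sA i j : smooth (fun q => A q i j).
  have -> : (fun q => A q i j) = fun q => F i q (f j).
    by apply/funext => q; rewrite mxE.
  exact: field_app.
pose W := V `&` [set q | \det (A q) != 0].
have oW : open W.
  apply: smooth_openN0 => //; apply: smooth_on_det => // i j;
    exact: smooth_smooth_on.
have uA q : W q -> A q \in unitmx by move=> [_ /=]; rewrite unitmxE unitfE.
have WV q : W q -> V q by case.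
pose omega i q (v : tvec M) := \sum_j v (f j) * invmx (A q) j i.
have omega_lin i q a u v :
    omega i q (a *: u + v) = a * omega i q u + omega i q v.
  rewrite /omega mulr_sumr -big_split /=; apply: eq_bigr => j _.
  by rewrite !fctE mulrDl mulrA.
have omega_sum i q (a : 'rV[R]_n) :
    omega i q (\sum_k a 0 k *: F k q) = (a *m (A q *m invmx (A q))) 0 i.
  rewrite mulmxA mxE; apply: eq_bigr => j _; congr (_ * _).
  by rewrite mxE fct_sumE; apply: eq_bigr => k _; rewrite mxE.
have omega_coord i q (a : 'rV[R]_n) : W q ->
  omega i q (\sum_k a 0 k *: F k q) = a 0 i.
  by move=> Wq; rewrite omega_sum mulmxV ?mulmx1 //; exact: uA.
have combF q a : W q -> combination E a q = \sum_k a 0 k *: F k q.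
  by move=> /WV Vq; apply: eq_bigr => k _; rewrite FE.
have expand q v : W q -> tangent q v -> v = \sum_i omega i q v *: F i q.
  move=> Wq /(frE q (VU _ (WV _ Wq)) v) [a [va _]].
  rewrite combF // in va; rewrite {1}va; apply: eq_bigr => k _.
  by rewrite va omega_coord.
exists W, F, i0, omega; split; first by split=> //=; rewrite -unitfE -unitmxE.
split=> //.
- move=> i ii0; split=> // q; have [Uq|nUq] := pselect (U q); last first.
    by rewrite /F phi0 ?scale0r; [exact: dist0|move/KU].
  rewrite CE //; exists (\row_k (phi q * (k == i)%:R)).
    by rewrite /= mxE eq_sym (negbTE ii0) mulr0.
  rewrite /combination (bigD1 i) //= big1 ?addr0 => [|k ki].
    by rewrite mxE eqxx mulr1.
  by rewrite mxE (negbTE ki) mulr0 scale0r.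
- move=> i j q Wq; have := omega_coord i q (\row_k (k == j)%:R) Wq.
  rewrite mxE (bigD1 j) //= big1 ?addr0 => [|k kj].
    by rewrite mxE eqxx scale1r.
  by rewrite mxE (negbTE kj) scale0r.
- move=> q v Wq tv; rewrite CE; last exact/VU/WV.
  split=> [[a a0 <-]|v0]; first by rewrite combF // omega_coord.
  exists (\row_i omega i q v); first by rewrite /= mxE.
  by rewrite combF // [RHS](expand q v Wq tv); apply: eq_bigr => k _;
    rewrite mxE.
- move=> i X vX; apply: smooth_on_sum => // j _; apply: smooth_onM => //.
    by apply: smooth_smooth_on; exact: field_app.
  by apply: smooth_on_invmx => // k l; exact: smooth_smooth_on.
Qed.

Lemma coframe0 W F i0 omega i q : adapted_frame W F i0 omega ->
  omega i q 0 = 0.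
Proof.
by move=> fr; have := coframeP fr i q (-1) 0 0;
  rewrite scaler0 addr0 mulN1r addNr.
Qed.

Lemma coframe_sum W F i0 omega i q (r : 'I_n -> R) (v : 'I_n -> tvec M) :
  adapted_frame W F i0 omega ->
  omega i q (\sum_j r j *: v j) = \sum_j r j * omega i q (v j).
Proof.
move=> fr; apply: (big_ind2 (fun u a => omega i q u = a)).
- exact: coframe0 fr.
- by move=> u a v' b <- <-; have := coframeP fr i q 1 u v';
  rewrite scale1r mul1r.
- move=> j _; have := coframeP fr i q (r j) (v j) 0.
  by rewrite (coframe0 _ _ fr) !addr0.
Qed.

End Distribution.

(** * The contact lift *)

Section Contact.
Variables (R : realType) (n : nat) (M : manifold R n) (C : M -> set (tvec M)).
Hypothesis hC : contact_structure C.
Implicit Types (p q : M) (u v : tvec M) (X Y Z S : vfield M) (U V W : set M).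

Let hD : corank_one_distribution C. Proof. by case: hC. Qed.

(** Near [q] one has [S = \sum_i a_i F_i] with [F_i] in the distribution and
    [a_i q = 0], so that [[S, X] q = - \sum_i X(a_i) F_i q].  Multiplying by a
    bump makes the identity global, hence available to the derivation [X q]. *)
Lemma bracket_vanishing S X q : sections C S -> vector_fields X -> S q = 0 ->
  C q (bracket S X q).
Proof.
move=> [vS CS] vX Sq0.
have [W [F [i0 [omega [Wq fr]]]]] := adapted_frame_exists hD q.
have oW := frame_open fr.
have [phi [V [K [sphi [_ Vq] phi1 [cK KW] phi0]]]] := bump_function oW Wq.
have tX := field_tangent q vX.
pose b i s := phi s * omega i s (S s).
have sb i : smooth (b i).
  exact: (smooth_bumpM oW sphi cK KW phi0 (coframe_smooth fr i vS)).
have bq i : b i q = 0 by rewrite /b Sq0 (coframe0 _ _ fr) mulr0.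
have expand s : phi s *: S s = \sum_i b i s *: F i s.
  have [Ks|/phi0 phis] := pselect (K s); last first.
    by rewrite phis scale0r big1 // => i _; rewrite /b phis mul0r scale0r.
  have {1}-> := coframe_expand fr (KW _ Ks) (field_tangent s vS).
  by rewrite scaler_sumr; apply: eq_bigr => i _; rewrite scalerA.
have b_i0 : b i0 = fun=> 0.
  apply/funext => s; rewrite /b; have [Ks|/phi0 ->] := pselect (K s);
    last by rewrite mul0r.
  rewrite (coframe_dist fr (KW _ Ks) (field_tangent s vS)).1 ?mulr0 //;
    exact: CS.
have -> : bracket S X q = - \sum_i X q (b i) *: F i q.
  apply/funext => f; rewrite /bracket Sq0 !fctE sub0r fct_sumE; congr (- _).
  have sF i : smooth (fun s => F i s f).
    by apply: field_app; exact: frame_field fr i.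
  have sS : smooth (fun s => S s f) by exact: field_app.
  have : X q (fun s => phi s * S s f) = X q (fun s => \sum_i b i s * F i s f).
    congr (X q); apply/funext => s; have := congr1 (fun v => v f) (expand s).
    by rewrite fct_sumE.
  rewrite (tangent_fM tX) // Sq0 (phi1 _ Vq) mul1r mul0r addr0 => ->.
  rewrite (tangent_fsum tX); last first.
    by move=> i; exact: (smooth_onM (@openT _) (sb i) (sF i)).
  apply: eq_bigr => i _; rewrite (tangent_fM tX (f := b i)) // bq mul0r add0r.
  by rewrite mulrC.
apply: distN => //; apply: dist_sum => // i _.
have [->|/(frame_section fr) [_ CF]] := eqVneq i i0.
  by rewrite b_i0 (tangent_f0 tX) scale0r; exact: dist0.
by apply: distZ.
Qed.

(** This is the tensoriality which turns conditions on sections into conditions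
    at a point. *)
Lemma bracket_congr S S' X q : sections C S -> sections C S' ->
  vector_fields X -> S q = S' q ->
  C q (bracket S X q - bracket S' X q).
Proof.
move=> sS sS' vX SS'; rewrite -bracketBl //; [|by case: sS|by case: sS'].
by apply: bracket_vanishing => //;
  [exact: sectionsB|rewrite -[LHS]/(S q - S' q) SS' subrr].
Qed.

Lemma sections_sumZ (a : 'I_n -> R) (Y : 'I_n -> vfield M) (P : pred 'I_n) :
  (forall i, P i -> sections C (Y i)) ->
  sections C (fun q => \sum_(i | P i) a i *: Y i q).
Proof.
move=> sY; split; last first.
  by move=> q; apply: dist_sum => // i /sY [_ CY]; exact: distZ.
apply: smooth_field_sumZ; [exact: openT|move=> i _; exact: smooth_on_cst|].
by move=> i /sY [].
Qed.

Lemma section_extension q u : C q u -> exists2 S, sections C S & S q = u.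
Proof.
move=> Cu; have tu := dist_tangent hD Cu.
have [W [F [i0 [omega [Wq fr]]]]] := adapted_frame_exists hD q.
exists (fun s => \sum_(i | i != i0) omega i q u *: F i s).
  exact/sections_sumZ/(frame_section fr).
rewrite [RHS](coframe_expand fr Wq tu) [RHS](bigD1 i0) //=.
by rewrite (coframe_dist fr Wq tu).1 // scale0r add0r.
Qed.

(** This is the pointwise non-degeneracy tested on sections: the bracket is
    tensorial, and every vector of the distribution extends to a section. *)
Lemma section_nondegenerate Z q : sections C Z ->
  (forall Y, sections C Y -> C q (bracket Z Y q)) -> Z q = 0.
Proof.
move=> sZ ZY; have [_ nd] := hC; have [vZ CZ] := sZ.
apply: nd (CZ q) _ => v Cv; apply/seteqP; split=> w.
  move=> [X [Y [sX sY XZ Yv wXY]]]; rewrite /normal_class /= subr0.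
  have [vY _] := sY; rewrite /normal_class /= in wXY.
  apply: (dist_subl hD wXY).
  exact: dist_subl (bracket_congr sX sZ vY XZ) (ZY _ sY).
rewrite /normal_class /= subr0 => Cw.
have [Y sY Yv] := section_extension Cv.
by exists Z, Y; split=> //; rewrite /normal_class /=; apply: distB => //;
  exact: ZY.
Qed.

(** [u] is the value at [q] of the contact correction of [X]; by tensoriality
    it suffices to test one section [S] with [S q = u]. *)
Definition correction_value X q u : Prop := C q u /\
  forall S Y, sections C S -> sections C Y -> S q = u ->
    C q (bracket S Y q - bracket Y X q).

Lemma correction_value_ext X q u S : vector_fields X -> sections C S ->
  S q = u ->
  (forall Y, sections C Y -> C q (bracket S Y q - bracket Y X q)) ->
  correction_value X q u.
Proof.
move=> vX sS Su SY; split=> [|S' Y sS' sY S'u]; first by rewrite -Su; case: sS.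
have [vY _] := sY; rewrite -Su in S'u.
exact: dist_trans (bracket_congr sS' sS vY S'u) (SY _ sY).
Qed.

Lemma correction_value_uniq X q u u' : correction_value X q u ->
  correction_value X q u' -> u = u'.
Proof.
move=> [Cu su] [Cu' su'].
have [S sS Su] := section_extension Cu.
have [S' sS' Su'] := section_extension Cu'.
apply/eqP; rewrite -subr_eq0 -Su -Su'; apply/eqP.
apply: (section_nondegenerate (Z := S - S')) => [|Y sY]; first exact: sectionsB.
have [[vS _] [vS' _] [vY _]] := And3 sS sS' sY.
rewrite bracketBl //.
apply: (dist_trans hD (su _ _ sS sY Su)).
rewrite -opprB; apply: distN => //; exact: su'.
Qed.

Lemma contact_correctionP X Z : vector_fields X ->
  contact_correction C X Z <->
  vector_fields Z /\ forall q, correction_value X q (Z q).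
Proof.
move=> vX; split=> [[sZ ZY]|[vZ sZ]].
  have [vZ _] := sZ; split=> // q.
  by apply: correction_value_ext sZ _ _ => // Y sY; exact: ZY.
have secZ : sections C Z by split=> // q; case: (sZ q).
by split=> // Y sY q; case: (sZ q) => _; apply.
Qed.

(** The class of the field near [q] determines its contact lift at [q]:
    where [X - X'] lies in the distribution it may be added to a solution. *)
Lemma contact_lift_local V X X' q u u' : open V -> V q ->
  vector_fields X -> vector_fields X' -> (forall s, V s -> C s (X s - X' s)) ->
  correction_value X q u -> correction_value X' q u' -> X q + u = X' q + u'.
Proof.
move=> oV Vq vX vX' CXX' [Cu su] su'.
have [phi [V' [K [sphi [_ V'q] phi1 [cK KV] phi0]]]] := bump_function oV Vq.
pose D : vfield M := X - X'; have vD : vector_fields D by exact: vector_fieldsB.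
pose D' : vfield M := fun s => phi s *: D s.
have sD' : sections C D'.
  split=> [|s]; first exact: (vector_fields_bump (@openT M) sphi cK _ phi0 vD).
  have [Ks|/phi0 phis] := pselect (K s); last first.
    by rewrite /D' phis scale0r; exact: dist0.
  by apply: distZ => //; exact/CXX'/KV.
have D'q : D' q = X q - X' q by rewrite /D' (phi1 _ V'q) scale1r.
have [S sS Su] := section_extension Cu.
suff /(correction_value_uniq su') -> : correction_value X' q (u + D' q).
  by rewrite D'q [RHS]addrCA [X' q + _]addrC subrK [LHS]addrC.
have sSD : sections C (S + D').
  have [vS CS] := sS; have [vD' CD'] := sD'.
  by split=> [|s]; [exact: vector_fieldsD|exact: distD].
apply: (correction_value_ext vX' sSD); first by rewrite !fctE Su.
move=> Y sY; have [[vS _] [vD' _] [vY _]] := And3 sS sD' sY.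
(* [[D', Y]] and [[D, Y]] differ at [q] by a multiple of [D q] *)
have CD : C q (bracket D' Y q - bracket D Y q).
  rewrite bracketMl // (phi1 _ V'q) scale1r addrAC subrr sub0r.
  by apply: distN => //; apply: distZ => //; exact: CXX'.
have := distD hD (su _ _ sS sY Su) CD.
rewrite bracketDl // /D bracketBl //
  [bracket X Y q]bracketC [bracket X' Y q]bracketC.
by congr (C q _); apply/funext => f; rewrite !fctE; ring.
Qed.

(** Only the members of an adapted frame that lie in the distribution need to
    be tested, again because the bracket is tensorial. *)
Lemma bracket_frame_test W F i0 omega T q : adapted_frame C W F i0 omega ->
  W q -> vector_fields T -> (forall j, j != i0 -> C q (bracket T (F j) q)) ->
  forall Y, sections C Y -> C q (bracket T Y q).
Proof.
move=> fr Wq vT CT Y sY; have [vY CY] := sY.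
pose Y' : vfield M := fun s => \sum_(j | j != i0) omega j q (Y q) *: F j s.
have sY' : sections C Y' by exact/sections_sumZ/(frame_section fr).
have tY := field_tangent q vY.
have YY' : Y q = Y' q.
  rewrite [LHS](coframe_expand fr Wq tY) [LHS](bigD1 i0) //=.
  by rewrite (coframe_dist fr Wq tY).1 // scale0r add0r.
rewrite bracketC; apply: distN => //.
apply: dist_subl (bracket_congr sY sY' vT YY') _ => //.
rewrite bracket_suml //; last by move=> j _; exact: frame_field fr j.
by apply: dist_sum => // j ji0; apply: distZ => //; rewrite bracketC;
  apply: distN => //; exact: CT.
Qed.

(** In an adapted frame the equation for the correction is a linear system,
    with matrix [omega_i0 [F_i, F_j]] for [i, j != i0], which is invertible by
    non-degeneracy; so its solution is smooth. *)
Lemma correction_value_local X p : vector_fields X -> exists W Z,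
  [/\ open W, W p, smooth_field_on W Z
    & forall q, W q -> correction_value X q (Z q)].
Proof.
move=> vX; have [W [F [i0 [omega [Wp fr]]]]] := adapted_frame_exists hD p.
have oW := frame_open fr; have vF := frame_field fr.
have vFF i j : vector_fields (bracket (F i) (F j)).
  exact: bracket_vector_fields.
(* Column [i0] of the system reads [z i0 = 0]: the solution is in [C]. *)
pose B q := \matrix_(i, j)
  (if j == i0 then (i == i0)%:R else omega i0 q (bracket (F i) (F j) q)).
pose r q := \row_j (if j == i0 then 0 else - omega i0 q (bracket X (F j) q)).
pose comb (z : 'rV[R]_n) : vfield M := fun s => \sum_i z 0 i *: F i s.
have zB_i0 q (z : 'rV[R]_n) : (z *m B q) 0 i0 = z 0 i0.
  rewrite mxE (bigD1 i0) //= big1 ?addr0 => [|i ii0];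
    first by rewrite mxE !eqxx mulr1.
  by rewrite mxE eqxx (negbTE ii0) mulr0.
have zB q (z : 'rV[R]_n) j : j != i0 ->
  (z *m B q) 0 j = omega i0 q (bracket (comb z) (F j) q).
  move=> ji0; rewrite bracket_suml // (coframe_sum _ _ _ _ fr) mxE.
  by apply: eq_bigr => i _; rewrite mxE (negbTE ji0).
have s_comb (z : 'rV[R]_n) : z 0 i0 = 0 -> sections C (comb z).
  move=> z0; rewrite (_ : comb z = fun s => \sum_(i | i != i0) z 0 i *: F i s).
    exact/sections_sumZ/(frame_section fr).
  by apply/funext => s; rewrite /comb (bigD1 i0) //= z0 scale0r add0r.
have inC q (v : vfield M) : W q -> vector_fields v -> omega i0 q (v q) = 0 ->
  C q (v q).
  by move=> Wq vv v0; apply/(coframe_dist fr Wq (field_tangent q vv)).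
have uB q : W q -> B q \in unitmx.
  move=> Wq; rewrite -row_free_unit; apply: inj_row_free => z zB0.
  have z0 : z 0 i0 = 0 by rewrite -(zB_i0 q) zB0 mxE.
  have sz := s_comb z z0; have [vz _] := sz.
  have combz0 : comb z q = 0.
    apply: section_nondegenerate => //.
    apply: (bracket_frame_test fr Wq vz) => j ji0.
    apply: inC => //; first exact: bracket_vector_fields.
    by rewrite -zB // zB0 mxE.
  apply/rowP => i; rewrite [RHS]mxE.
  have := coframe0 i q fr; rewrite -combz0 (coframe_sum _ _ _ _ fr).
  rewrite (bigD1 i) //= (coframe_dual fr) // eqxx mulr1 big1 ?addr0 // => k ki.
  by rewrite (coframe_dual fr) // eq_sym (negbTE ki) mulr0.
pose z q := r q *m invmx (B q).
have zr q : W q -> z q *m B q = r q by move=> /uB uBq; rewrite /z mulmxKV.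
exists W, (fun q => comb (z q) q); split=> //.
  apply: smooth_field_sumZ => // i _; last exact: smooth_field_sub.
  apply: smooth_on_mulmx => // [i' j|].
    have [ji0|ji0] := eqVneq j i0.
      have -> : (fun q => r q i' j) = fun=> 0.
        by apply/funext => q; rewrite mxE ji0 eqxx.
      exact: smooth_on_cst.
    have -> : (fun q => r q i' j) = fun q => - omega i0 q (bracket X (F j) q).
      by apply/funext => q; rewrite mxE (negbTE ji0).
    apply: smooth_onN => //.
    exact: (coframe_smooth fr i0 (bracket_vector_fields vX (vF j))).
  apply: smooth_on_invmx => // k j.
  have [ji0|ji0] := eqVneq j i0.
    have -> : (fun q => B q k j) = fun=> (k == i0)%:R.
      by apply/funext => q; rewrite mxE ji0 eqxx.
    exact: smooth_on_cst.
  have -> : (fun q => B q k j) = fun q => omega i0 q (bracket (F k) (F j) q).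
    by apply/funext => q; rewrite mxE (negbTE ji0).
  exact: (coframe_smooth fr i0 (vFF k j)).
move=> q Wq; have z0 : z q 0 i0 = 0 by rewrite -(zB_i0 q) zr // mxE eqxx.
have sz := s_comb _ z0; have [vz _] := sz.
have vT : vector_fields (comb (z q) + X) by exact: vector_fieldsD.
apply: (correction_value_ext vX sz) => // Y sY; have [vY _] := sY.
rewrite [bracket Y X q]bracketC opprK -bracketDl //.
apply: (bracket_frame_test fr Wq vT) => // j ji0.
apply: inC => //; first exact: bracket_vector_fields.
rewrite bracketDl //; have :=
  coframeP fr i0 q 1 (bracket (comb (z q)) (F j) q) (bracket X (F j) q).
by rewrite scale1r mul1r => ->; rewrite -zB // zr // mxE (negbTE ji0) addNr.
Qed.

Lemma contact_correction_exists X : vector_fields X ->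
  exists Z, contact_correction C X Z.
Proof.
move=> vX; have /choice[Z sZ] : forall q, exists u, correction_value X q u.
  by move=> q; have [W [Z [_ Wq _ sZ]]] := correction_value_local q vX;
    exists (Z q); exact: sZ.
exists Z; apply/contact_correctionP => //; split=> //.
apply: smooth_field_local => p _.
have [W [Z0 [oW Wp sZ0 WZ0]]] := correction_value_local p vX.
exists W => //; apply: smooth_field_eq sZ0 => // q Wq.
exact: correction_value_uniq (WZ0 q Wq) (sZ q).
Qed.

Lemma contact_correction_uniq X Z Z' : vector_fields X ->
  contact_correction C X Z -> contact_correction C X Z' -> Z = Z'.
Proof.
move=> vX /(contact_correctionP _ vX)[_ sZ] /(contact_correctionP _ vX)[_ sZ'].
by apply/funext => q; exact: correction_value_uniq (sZ q) (sZ' q).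
Qed.

Lemma contact_lift_eq V X X' Z Z' : open V ->
  vector_fields X -> vector_fields X' ->
  contact_correction C X Z -> contact_correction C X' Z' ->
  (forall q, V q -> normal_class_field C X q = normal_class_field C X' q) ->
  forall q, V q -> (X + Z) q = (X' + Z') q.
Proof.
move=> oV vX vX' /(contact_correctionP _ vX)[_ sZ].
move=> /(contact_correctionP _ vX')[_ sZ'] XX' q Vq.
apply: (contact_lift_local oV Vq vX vX' _ (sZ q) (sZ' q)) => s /XX'.
by move/normal_class_eq; exact.
Qed.

Lemma contact_lift_class X Z : contact_correction C X Z ->
  normal_class_field C (X + Z) = normal_class_field C X.
Proof.
move=> [[_ CZ] _]; apply/funext => q; apply/normal_class_eq => //.
by rewrite -[(X + Z) q]/(X q + Z q) addrAC subrr add0r; exact: CZ.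
Qed.

Lemma contact_lift_contact X Z : vector_fields X -> contact_correction C X Z ->
  contact_fields C (X + Z).
Proof.
move=> vX [[vZ CZ] ZY]; split=> [|Y sY]; first exact: vector_fieldsD.
have [vY _] := sY; split=> [|q].
  by apply: bracket_vector_fields => //; exact: vector_fieldsD.
by have := ZY Y sY q; rewrite bracketDl // [bracket Y X q]bracketC opprK addrC.
Qed.

Lemma contact_field_correction0 X : contact_fields C X ->
  contact_correction C X 0.
Proof.
move=> [vX XY]; split=> [|Y sY q].
  by split=> [|q]; [exact: vector_fields0|exact: dist0].
have [vY _] := sY; have := bracketDl q vX (vector_fields0 M) vY.
rewrite addr0 => /eqP; rewrite addrC -subr_eq subrr eq_sym => /eqP ->.
by rewrite [bracket Y X q]bracketC opprK add0r; case: (XY Y sY).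
Qed.

(** The contact lift depends only on the class near each point, so the lifts of
    local representatives glue to a field that represents the section; this
    replaces a partition of unity. *)
Lemma normal_section_lift s : normal_sections C s ->
  exists2 X, vector_fields X & normal_class_field C X = s.
Proof.
move=> ss.
(* near each point: a neighbourhood, a global representative, its correction *)
have /choice[G GP] : forall p, exists G : set M * vfield M * vfield M,
    [/\ open G.1.1 /\ G.1.1 p, vector_fields G.1.2,
      contact_correction C G.1.2 G.2
      & forall q, G.1.1 q -> s q = normal_class_field C G.1.2 q].
  move=> p; have [U [X [oU Up sX Xs]]] := ss p.
  have [phi [V [K [sphi [oV Vp] phi1 [cK KU] phi0]]]] := bump_function oU Up.
  have vX := vector_fields_bump oU sphi cK KU phi0 sX.
  have [Z cZ] := contact_correction_exists vX.
  exists (V, fun q => phi q *: X q, Z); split=> //= q Vq.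
  have Uq : U q.
    apply: KU; apply: contrapT => /phi0; rewrite (phi1 _ Vq);
      exact/eqP/oner_neq0.
  by rewrite Xs // /normal_class_field (phi1 _ Vq) scale1r.
pose L p := (G p).1.2 + (G p).2.
have vL p : vector_fields (L p).
  by have [_ vX [[vZ _] _] _] := GP p; exact: vector_fieldsD.
exists (fun p => L p p).
  apply: smooth_field_local => p _; have [[oV Vp] vX cX sX] := GP p.
  exists (G p).1.1 => //; apply: smooth_field_eq (smooth_field_sub _ (vL p)) =>
    // q Vq.
  have [[oV' V'q] vX' cX' sX'] := GP q.
  apply: (contact_lift_eq (openI oV oV') vX vX' cX cX') => // t [Vt V't].
  by rewrite -sX // -sX'.
apply/funext => p; have [[oV Vp] vX cX sX] := GP p.
by rewrite sX // -(contact_lift_class cX).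
Qed.

End Contact.

Theorem lemma3p4 (R : realType) (n : nat) (M : manifold R n)
    (C : M -> set (tvec M)) (hC : contact_structure C) :
  (forall X : vfield M, vector_fields X ->
     exists! Z : vfield M, contact_correction C X Z) /\
  (forall h : vfield M -> vfield M,
     (forall X, vector_fields X -> contact_correction C X (h X)) ->
     normal_sections C = [set normal_class_field C X | X in @vector_fields R n M] /\
     (forall X X', vector_fields X -> vector_fields X' ->
        normal_class_field C X = normal_class_field C X' ->
        X + h X = X' + h X') /\
     (exists K : (M -> set (tvec M)) -> vfield M,
        (forall X, vector_fields X -> K (normal_class_field C X) = X + h X) /\
        set_bij (normal_sections C) (contact_fields C) K)).
Proof.
split=> [X vX|h hP].
  have [Z cZ] := contact_correction_exists hC vX.
  by exists Z; split=> // Z' cZ';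
    exact: contact_correction_uniq hC _ _ _ vX cZ cZ'.
have sections_lift : normal_sections C =
    [set normal_class_field C X | X in @vector_fields R n M].
  apply/seteqP; split=> [s /(normal_section_lift hC)[X vX Xs]|_ [X vX <-] p].
    by exists X.
  by exists setT, X; split=> //; exact: openT.
have wd X X' : vector_fields X -> vector_fields X' ->
    normal_class_field C X = normal_class_field C X' -> X + h X = X' + h X'.
  move=> vX vX' XX'; apply/funext => q.
  by apply: (contact_lift_eq hC (@openT M) vX vX' (hP _ vX) (hP _ vX')) => //
    p _; rewrite XX'.
split=> //; split=> //.
have /choice[rep repP] : forall s, exists X, normal_sections C s ->
    vector_fields X /\ normal_class_field C X = s.
  move=> s; have [/(normal_section_lift hC)[X vX Xs]|ns] :=
    pselect (normal_sections C s).
    by exists X.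
  by exists 0.
exists (fun s => rep s + h (rep s)).
have KP X : vector_fields X ->
    rep (normal_class_field C X) + h (rep (normal_class_field C X)) = X + h X.
  move=> vX; have [|vr rX] := repP (normal_class_field C X).
    by rewrite sections_lift; exists X.
  exact: wd.
split=> //; split.
- move=> s /repP[vr _]; exact: contact_lift_contact (hP _ vr).
- move=> s s' /set_mem /repP[vr rs] /set_mem /repP[vr' rs'] ss'.
  by rewrite -rs -rs' -(contact_lift_class hC (hP _ vr)) ss'
    (contact_lift_class hC (hP _ vr')).
- move=> X cX; have [vX _] := cX; exists (normal_class_field C X).
    by rewrite sections_lift; exists X.
  have cX0 := contact_field_correction0 hC cX.
  have h0 := contact_correction_uniq hC vX (hP _ vX) cX0.
  by rewrite KP // h0 addr0.
Qed.
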